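(* Let $X$ be the Markov mixture process on $\mathbb{S}=E\cup\{\Delta\}$, let $\Gamma_1,\Gamma_2$ be stochastically closed subsets of $\mathbb{S}$ with $\Gamma_1\cap\Gamma_2=\{\Delta\}$, and $\tau_l=\inf\{t\ge0:X_t\in\Gamma_l\}$, $l=1,2$. The distribution $\overline F_t(t_1,t_2)=\mathbb{P}\{\tau_1>t_1,\tau_2>t_2\mid\mathcal{G}_t\}$ is given by $$\overline F_t(t_1,t_2)=\begin{cases}\sum_{k=1}^m\boldsymbol\pi^{\top}(t)\mathbf{S}^{(k)}(t)e^{\mathbf{B}^{(k)}(t_2-t)}\mathbf{H}_2e^{\mathbf{B}^{(k)}(t_1-t_2)}\mathbf{H}_1\mathbb{1},&t_1\ge t_2\ge t\ge0,\\[4pt]\sum_{k=1}^m\boldsymbol\pi^{\top}(t)\mathbf{S}^{(k)}(t)e^{\mathbf{B}^{(k)}(t_1-t)}\mathbf{H}_1e^{\mathbf{B}^{(k)}(t_2-t_1)}\mathbf{H}_2\mathbb{1},&t_2\ge t_1\ge t\ge0.\end{cases}$$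
   Context: Mixture process: $E=\{1,\dots,n\}$ are the transient states, $\Delta=n+1$ is the absorbing state, $\mathbb{S}=E\cup\{\Delta\}$. For $k=1,\dots,m$, $\mathbf{Q}^{(k)}=\begin{pmatrix}\mathbf{B}^{(k)}&-\mathbf{B}^{(k)}\mathbb{1}\\ \mathbf{0}&0\end{pmatrix}$ is an intensity matrix on $\mathbb{S}$ (nonnegative off-diagonal entries, zero row sums) with $\mathbf{B}^{(k)}$ an $n\times n$ nonsingular matrix. On a probability space there are an unobserved regime $\phi\in\{1,\dots,m\}$ and an $\mathbb{S}$-valued right-continuous process $X=(X_t)_{t\ge0}$ such that $\mathbb{P}\{X_0=i\}=\pi_i$ for $i\in E$, $\mathbb{P}\{X_0=\Delta\}=0$, $\mathbb{P}\{\phi=k\mid X_0=i\}=s_i^{(k)}$ with $\sum_k s_i^{(k)}=1$, and, given $\phi=k$ and $X_0=i$, $X$ is a time-homogeneous Markov jump process with intensity matrix $\mathbf{Q}^{(k)}$ started at $i$. Closed sets: $\Gamma_l$ stochastically closed means $[\mathbf{Q}^{(k)}]_{i,j}=0$ for all $k$ whenever $i\in\Gamma_l$, $j\in\Gamma_l^c$. It is assumed that $\pi_i\ne0$ for $i\in\Gamma_1^c\cap\Gamma_2^c$ and $\mathbb{P}\{\tau_1>0,\tau_2>0\}=1$. $\mathbf{H}_l$ is the $n\times n$ diagonal matrix with $[\mathbf{H}_l]_{ii}=1$ if $i\in\Gamma_l^c$ and $0$ otherwise, $i\in E$. Information: $\mathcal{F}_{t-}$ is any sub-$\sigma$-field of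 $\sigma(X_s:0\le s<t)$ (full, partial, or no information). $\mathcal{F}_{t,i}$ denotes $\mathcal{F}_{t-}$ together with $X_t=i$: $\mathbb{P}\{A\mid\mathcal{F}_{t,i}\}:=\mathbb{P}\{A\cap\{X_t=i\}\mid\mathcal{F}_{t-}\}/\mathbb{P}\{X_t=i\mid\mathcal{F}_{t-}\}$ where the denominator is positive. $\mathcal{G}_t$ is either $\mathcal{F}_{t-}$ together with the event $X_t\ne\Delta$, meaning $\mathbb{P}\{A\mid\mathcal{G}_t\}:=\mathbb{P}\{A\cap\{X_t\ne\Delta\}\mid\mathcal{F}_{t-}\}/\mathbb{P}\{X_t\ne\Delta\mid\mathcal{F}_{t-}\}$ where the denominator is positive, or simply $\mathcal{G}_t=\mathcal{F}_{t-}$. Identities are almost sure, where defined. $\boldsymbol\pi(t)=(\pi_1(t),\dots,\pi_n(t))^\top$ with $\pi_i(t)=\mathbb{P}\{X_t=i\mid\mathcal{G}_t\}$; $\mathbf{S}^{(k)}(t)=\mathrm{diag}(s_1^{(k)}(t),\dots,s_n^{(k)}(t))$ with $s_i^{(k)}(t)=\mathbb{P}\{\phi=k\mid\mathcal{F}_{t,i}\}$ (completed arbitrarily to nonnegative weights summing to $1$ over $k$ where undefined). $\mathbb{1}$ is the all-ones vector. *)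

(* Defs.v *)
From HB Require Import structures.
From mathcomp Require Import all_boot all_order all_algebra.
From mathcomp Require Import all_classical all_reals all_analysis.

Set Implicit Arguments.
Unset Strict Implicit.
Unset Printing Implicit Defensive.
Import Order.TTheory GRing.Theory Num.Theory.
Import numFieldNormedType.Exports.
Local Open Scope classical_set_scope.
Local Open Scope ring_scope.

(* The state space is 'I_(n + 1): the transient states are embedded by
   [lshift 1], and the last state is the absorbing one. *)
Definition trans (n : nat) (i : 'I_n) : 'I_(n + 1) := lshift 1 i.
Definition Delta (n : nat) : 'I_(n + 1) := rshift n ord0.

Section Matrices.
Context {R : realType}.

(* Entrywise sum of the exponential series. *)
Definition mexp (n : nat) (A : 'M[R]_n) : 'M[R]_n :=
  \matrix_(i, j) limn (series (fun k : nat => (A ^+ k) i j / (k`!)%:R)).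

Definition ones (n : nat) : 'cV[R]_n := const_mx 1.

Definition intensity_matrix (N : nat) (Q : 'M[R]_N) : Prop :=
  (forall i j, i != j -> 0 <= Q i j) /\ (forall i, \sum_j Q i j = 0).

Definition Qmx (n : nat) (B : 'M[R]_n) : 'M[R]_(n + 1) :=
  block_mx B (- (B *m ones n)) 0 0.

Definition Hmx (n : nat) (Gamma : {set 'I_(n + 1)}) : 'M[R]_n :=
  diag_mx (\row_i (trans i \notin Gamma)%:R).

Definition stoch_closed (n m : nat) (B : 'I_m -> 'M[R]_n)
    (Gamma : {set 'I_(n + 1)}) : Prop :=
  forall k i j, i \in Gamma -> j \notin Gamma -> Qmx (B k) i j = 0.

(* [p] is a standard transition semigroup whose generator, i.e. its right
   derivative at 0, is [Q]. *)
Definition transition_semigroup (N : nat) (Q : 'M[R]_N) (p : R -> 'M[R]_N) :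
    Prop :=
  [/\ forall t, 0 <= t -> (forall i j, 0 <= p t i j) /\
                          (forall i, \sum_j p t i j = 1),
      p 0 = 1%:M,
      forall s t, 0 <= s -> 0 <= t -> p (s + t) = p s *m p t
    & forall i j, (p h i j - (i == j)%:R) / h @[h --> 0^'+] --> Q i j].

End Matrices.

Section Conditioning.
Context {R : realType} {d : measure_display} {T : measurableType d}.
Variable P : probability T R.

(* Elementary conditional probability P(A | B), meaningful if P B != 0. *)
Definition cprob (A B : set T) : R := fine (P (A `&` B)) / fine (P B).

(* [Y] is a version of the conditional probability P(A | F), where [F] is a
   sub-sigma-field. *)
Definition cond_prob (F : set (set T)) (A : set T) (Y : T -> R) : Prop :=
  [/\ forall U : set R, measurable U -> F (Y @^-1` U),
      P.-integrable setT (EFin \o Y)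
    & forall C, F C -> (\int[P]_(w in C) (Y w)%:E = P (A `&` C))%E].

(* [Y] is a version of P(A | F, D) := P(A `&` D | F) / P(D | F); nothing is
   required of [Y] where the denominator is not positive. *)
Definition cond_prob_given (F : set (set T)) (D A : set T) (Y : T -> R) :
    Prop :=
  exists pAD pD : T -> R,
    [/\ cond_prob F (A `&` D) pAD, cond_prob F D pD
      & {ae P, forall w, 0 < pD w -> Y w = pAD w / pD w}].

(* Conditioning on G, which is "F together with D" if [b], and F otherwise. *)
Definition cond_prob_opt (F : set (set T)) (b : bool) (D A : set T)
    (Y : T -> R) : Prop :=
  if b then cond_prob_given F D A Y else cond_prob F A Y.

End Conditioning.

Section Processes.
Context {R : realType} {d : measure_display} {T : measurableType d}.
Variable P : probability T R.

(* Processes are functions of t : R, of which only the values at t >= 0 are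
   ever used. *)
Definition state_at (N : nat) (X : R -> T -> 'I_N) (t : R) (j : 'I_N) :
    set T := [set w | X t w = j].

(* The sigma-field generated by the X_u, u in I. *)
Definition sigma_path (N : nat) (X : R -> T -> 'I_N) (I : set R) :
    set (set T) :=
  <<s [set A | exists u j, I u /\ A = state_at X u j] >>.

(* The last condition is right-continuity for the discrete topology. *)
Definition right_continuous_process (N : nat) (X : R -> T -> 'I_N) : Prop :=
  (forall t j, 0 <= t -> measurable (state_at X t j)) /\
  (forall w t, 0 <= t -> \forall u \near t^'+, X u w = X t w).

(* Conditionally on the event [C], [X] is a time-homogeneous Markov process
   with generator [Q]: the conditional law of X_(s + h) given C, X_s = j and
   any event A of the past up to s is the row j of p h. *)
Definition markov_jump_given (N : nat) (X : R -> T -> 'I_N) (C : set T)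
    (Q : 'M[R]_N) : Prop :=
  exists2 p, transition_semigroup Q p &
    forall s h j l A, 0 <= s -> 0 <= h ->
      sigma_path X [set u | 0 <= u <= s] A ->
      P (A `&` state_at X s j `&` C) != 0%E ->
      cprob P (state_at X (s + h) l) (A `&` state_at X s j `&` C) = p h j l.

Record markov_mixture (n m : nat) (B : 'I_m -> 'M[R]_n) (p0 : 'I_n -> R)
    (s0 : 'I_m -> 'I_n -> R) (phi : T -> 'I_m)
    (X : R -> T -> 'I_(n + 1)) : Prop := MarkovMixture {
  mix_intensity : forall k, intensity_matrix (Qmx (B k));
  mix_nonsingular : forall k, B k \in unitmx;
  mix_phi_measurable : forall k, measurable [set w | phi w = k];
  mix_right_continuous : right_continuous_process X;
  mix_init : forall i, P (state_at X 0 (trans i)) = (p0 i)%:E;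
  mix_init_Delta : P (state_at X 0 (Delta n)) = 0%E;
  mix_weight_ge0 : forall k i, 0 <= s0 k i;
  mix_weight_sum : forall i, \sum_k s0 k i = 1;
  mix_regime : forall k i, p0 i != 0 ->
    cprob P [set w | phi w = k] (state_at X 0 (trans i)) = s0 k i;
  mix_markov : forall k i,
    markov_jump_given X
      (state_at X 0 (trans i) `&` [set w | phi w = k]) (Qmx (B k)) }.

(* Equal to +oo if [X] never visits [Gamma]. *)
Definition hitting_time (N : nat) (X : R -> T -> 'I_N) (Gamma : {set 'I_N})
    (w : T) : \bar R :=
  ereal_inf [set t%:E | t in [set t | 0 <= t /\ X t w \in Gamma]].

Definition joint_survival (N : nat) (X : R -> T -> 'I_N)
    (Gamma1 Gamma2 : {set 'I_N}) (t1 t2 : R) : set T :=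
  [set w | (t1%:E < hitting_time X Gamma1 w)%E /\
           (t2%:E < hitting_time X Gamma2 w)%E].

Definition alive (n : nat) (X : R -> T -> 'I_(n + 1)) (t : R) : set T :=
  [set w | X t w != Delta n].

(* [s k i] is P(phi = k | F, X_t = i), completed, where undefined, by arbitrary
   nonnegative weights summing to 1 over k. *)
Definition regime_weights (n m : nat) (phi : T -> 'I_m)
    (X : R -> T -> 'I_(n + 1)) (t : R) (F : set (set T))
    (s : 'I_m -> 'I_n -> T -> R) : Prop :=
  (forall k i, cond_prob_given P F (state_at X t (trans i))
                 [set w | phi w = k] (s k i)) /\
  (forall i q, cond_prob P F (state_at X t (trans i)) q ->
     {ae P, forall w, ~~ (0 < q w) ->
        (forall k, 0 <= s k i w) /\ \sum_k s k i w = 1}).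

End Processes.

(* Main.v *)
(* By right continuity, {tau_l > t_l} consists of the paths with X_(t_l) outside
   Gamma_l that avoid Gamma_l at all rational times before t_l; as Gamma_l is
   closed, it differs from {X_(t_l) \notin Gamma_l} by a null set.  Given the
   regime k, two applications of the Markov property express the probability of
   {X_(t_1) \notin Gamma_1, X_(t_2) \notin Gamma_2} and an event of F through
   P(phi = k, X_t = i, C) and the transition matrices, and dividing by versions
   of the conditional probabilities gives the formula.  The transition matrices
   are exponentials of the generator, because the semigroup equation p' = Q p
   bounds the n-th Taylor remainder of p by (c t)^n / n!. *)
Require Import Defs.
From HB Require Import structures.
From mathcomp Require Import all_boot all_order all_algebra.
From mathcomp Require Import all_classical all_reals all_analysis.
From mathcomp Require Import measurable_realfun.
From mathcomp Require Import ring.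
Set Implicit Arguments.
Unset Strict Implicit.
Unset Printing Implicit Defensive.
Import Order.TTheory GRing.Theory Num.Theory.
Import numFieldNormedType.Exports.
Local Open Scope classical_set_scope.
Local Open Scope ring_scope.

(** * Transition semigroups and matrix exponentials *)

(** Both [g + f] and [g - f] have nonnegative derivatives, hence are nondecreasing, and both start
    at 0. At 0 only right limits are asked for, since a semigroup is defined only for nonnegative
    times. *)
Lemma ler_norm_derive (R : realType) (f g f' g' : R -> R) :
  (forall x : R, 0 < x -> is_derive x 1 f (f' x)) ->
  (forall x : R, 0 < x -> is_derive x 1 g (g' x)) ->
  (forall x : R, 0 < x -> `|f' x| <= g' x) ->
  f x @[x --> 0^'+] --> f 0 -> g x @[x --> 0^'+] --> g 0 ->
  f 0 = 0 -> g 0 = 0 -> forall t, 0 <= t -> `|f t| <= g t.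
Proof.
move=> df dg le_fg cf cg f0 g0.
suff main (u u' : R -> R) : (forall x : R, 0 < x -> is_derive x 1 u (u' x)) ->
    (forall x : R, 0 < x -> 0 <= u' x) -> u x @[x --> 0^'+] --> u 0 ->
    u 0 = 0 -> forall t, 0 <= t -> 0 <= u t.
  move=> t t0; rewrite ler_norml -subr_ge0 opprK -(subr_ge0 (f t)); apply/andP; split.
    apply: (main (f + g) (f' + g')) => //.
    - by move=> x x0; apply: is_deriveD; [exact: df|exact: dg].
    - move=> x x0; have := le_fg x x0; rewrite ler_norml.
      by case/andP; rewrite -subr_ge0 opprK.
    - exact: cvgD.
    - by rewrite -[LHS]/(f 0 + g 0) f0 g0 addr0.
  apply: (main (g - f) (g' - f')) => //.
  - by move=> x x0; apply: is_deriveB; [exact: dg|exact: df].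
  - move=> x x0; have := le_fg x x0; rewrite ler_norml => /andP[_].
    by rewrite -subr_ge0.
  - exact: cvgB.
  - by rewrite -[LHS]/(g 0 - f 0) f0 g0 subr0.
move=> du u'0 cu u0 t t0; rewrite -{1}u0.
apply: (@ger0_derive1_ndecry _ u 0) => //.
- move=> x; rewrite in_itv/= andbT => x0.
  exact: (@ex_derive _ _ _ _ _ _ _ (du x x0)).
- move=> x; rewrite in_itv/= andbT => x0.
  by rewrite derive1E (@derive_val _ _ _ _ _ _ _ (du x x0)); exact: u'0.
- apply/continuous_within_itvcyP; split => // x; rewrite in_itv/= andbT => x0.
  apply/differentiable_continuous/derivable1_diffP.
  exact: (@ex_derive _ _ _ _ _ _ _ (du x x0)).
Qed.

Lemma cvg_sumr (R : realType) (I : finType) (U : Type) (F : set_system U)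
    (FF : Filter F) (f : I -> U -> R) (l : I -> R) :
  (forall i, f i x @[x --> F] --> l i) ->
  \sum_i f i x @[x --> F] --> \sum_i l i.
Proof. by move=> fl; apply: cvg_big => //; exact: add_continuous. Qed.

Lemma exprmxZ (R : comPzRingType) (n k : nat) (a : R) (A : 'M[R]_n) :
  (a *: A) ^+ k = a ^+ k *: A ^+ k.
Proof.
elim: k => [|k IH]; first by rewrite !expr0 scale1r.
by rewrite !exprS IH -[LHS]scalemxAl -scalemxAr scalerA.
Qed.

Section Semigroup.
Context (R : realType) (N : nat) (Q : 'M[R]_N) (p : R -> 'M[R]_N).
Hypothesis Hp : transition_semigroup Q p.

Lemma semigroup_norm_le1 (t : R) i j : 0 <= t -> `|p t i j| <= 1.
Proof.
case: Hp => + _ _ _ => /[apply] -[p0 p1].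
rewrite ger0_norm// -(p1 i) (bigD1 j)//= lerDl; exact: sumr_ge0.
Qed.

Let D (h : R) i j := (p h i j - (i == j)%:R) / h.

Let Dcvg i j : D h i j @[h --> 0^'+] --> Q i j.
Proof. by case: Hp => _ _ _; apply. Qed.

(** The semigroup law with the short time as the left factor: the increment is (p h - 1) p t. This
    order makes the generator act on the left. *)
Let pD (h t : R) i j : 0 < h -> 0 <= t ->
  p (h + t) i j - p t i j = h * \sum_l D h i l * p t l j.
Proof.
case: Hp => _ _ pM _ h0 t0; rewrite pM ?(ltW h0)// mxE mulr_sumr.
rewrite [X in _ - X = _](_ : _ = \sum_l (i == l)%:R * p t l j); last first.
  rewrite (bigD1 i)//= eqxx mul1r big1 ?addr0// => l li.
  by rewrite eq_sym (negbTE li) mul0r.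
rewrite -sumrB; apply: eq_bigr => l _; rewrite -mulrBl mulrA; congr (_ * _).
by rewrite /D mulrC divfK// gt_eqF.
Qed.

(** Continuity at 0 follows from differentiability there: p h = 1 + h D h, and D h converges. *)
Lemma semigroup_cvg0 i j : p h i j @[h --> 0^'+] --> ((i == j)%:R : R).
Proof.
have id0 : h @[h --> (0 : R)^'+] --> 0 by exact: cvg_at_right_filter.
apply: (@cvg_trans _ (h * D h i j + (i == j)%:R @[h --> 0^'+])).
  apply: near_eq_cvg; near=> h.
  have h0 : 0 < h by near: h; exact: nbhs_right_gt.
  by rewrite /= /D mulrC divfK ?subrK// gt_eqF.
have := cvgD (cvgM id0 (@Dcvg i j)) (@cvg_cst _ ((i == j)%:R : R) _ ((0 : R)^'+) _).
by rewrite mul0r add0r; apply.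
Unshelve. all: by end_near. Qed.

(** Entries of p are at most 1 in absolute value, so the increment over [t - h, t] is at most h
    times the absolute row sum of D h, which tends to 0. *)
Lemma semigroup_left_cvg (t : R) i j : 0 < t -> p (t - h) i j @[h --> 0^'+] --> p t i j.
Proof.
move=> t0.
have id0 : h @[h --> (0 : R)^'+] --> 0 by exact: cvg_at_right_filter.
have B : h * \sum_l `|D h i l| @[h --> 0^'+] --> 0 * \sum_l `|Q i l|.
  by apply: (cvgM id0); apply: cvg_sumr => l; exact: cvg_norm.
apply/cvgrPdist_le => e e0.
move: B; rewrite mul0r => /cvgrPdist_le/(_ _ e0) B; near=> h.
have h0 : 0 < h by near: h; exact: nbhs_right_gt.
have ht : h <= t by near: h; exact: nbhs_right_le.
have th : 0 <= t - h by rewrite subr_ge0.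
have := @pD h (t - h) i j h0 th; rewrite (addrC h) subrK => ->.
apply: (@le_trans _ _ `|0 - h * \sum_l `|D h i l| |); last by near: h; exact: B.
rewrite sub0r normrN !normrM ler_wpM2l//.
rewrite [leRHS]ger0_norm; last exact: sumr_ge0.
apply: (le_trans (ler_norm_sum _ _ _)); apply: ler_sum => l _.
by rewrite normrM ler_piMr// semigroup_norm_le1// subr_ge0.
Unshelve. all: by end_near. Qed.

(** Kolmogorov's backward equation. The right difference quotient is D h p t; the left one is D h p
    (t - h), whose limit is the same by left continuity. *)
Lemma semigroup_is_derive (t : R) i j : 0 < t ->
  is_derive t 1 (fun u => p u i j) ((Q *m p t) i j).
Proof.
move=> t0.
suff H : h^-1 *: (((fun u => p u i j) \o shift t) (h *: 1) - p t i j) @[h --> 0^'] -->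
    (Q *m p t) i j.
  apply: DeriveDef; first by apply/cvg_ex; eexists; exact: H.
  exact: cvg_lim H.
apply: (@cvg_at_right_left_dnbhs _ R^o).
  apply: (@cvg_trans _ (\sum_l D h i l * p t l j @[h --> 0^'+])).
    apply: near_eq_cvg; near=> h => /=.
    have h0 : 0 < h by near: h; exact: nbhs_right_gt.
    by rewrite /= [h *: 1]mulr1 pD ?(ltW t0)// [RHS]mulKf// gt_eqF.
  rewrite mxE; apply: cvg_sumr => l; apply: (cvgM (@Dcvg i l)); exact: cvg_cst.
apply/cvg_at_leftNP; rewrite oppr0.
apply: (@cvg_trans _ (\sum_l D h i l * p (t - h) l j @[h --> 0^'+])).
  apply: near_eq_cvg; near=> h => /=.
  have h0 : 0 < h by near: h; exact: nbhs_right_gt.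
  have ht : h <= t by near: h; exact: nbhs_right_le.
  have th : 0 <= t - h by rewrite subr_ge0.
  have := @pD h (t - h) i j h0 th; rewrite (addrC h) subrK => E.
  rewrite [- h *: 1]mulr1 (addrC (- h)) -[X in _ *: X]opprB E.
  by rewrite invrN scaleNr scalerN opprK [RHS]mulKf// gt_eqF.
rewrite mxE; apply: cvg_sumr => l; apply: (cvgM (@Dcvg i l)).
exact: semigroup_left_cvg.
Unshelve. all: by end_near. Qed.

(** Taylor polynomial, of degree below n, of the entry (i, j) of exp(t Q). As a formal polynomial it
    brings its derivative and continuity with it. *)
Let taylor n i j : {poly R} := \poly_(k < n) ((Q ^+ k) i j / k`!%:R).

Let taylor_deriv n i j t :
  (taylor n.+1 i j)^`().[t] = \sum_l Q i l * (taylor n l j).[t].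
Proof.
have E : (taylor n.+1 i j)^`() = \sum_l Q i l *: taylor n l j.
  apply/polyP => k; rewrite coef_deriv coef_poly coef_sum ltnS.
  under eq_bigr do rewrite coefZ coef_poly.
  case: ltnP => _; last by rewrite mul0rn big1// => l _; rewrite mulr0.
  rewrite exprS mxE -[LHS]mulr_natr -mulrA.
  under [RHS]eq_bigr do rewrite mulrA.
  rewrite -mulr_suml; congr (_ * _).
  rewrite factS natrM invfM mulrAC mulVf ?mul1r//.
by rewrite E horner_sum; apply: eq_bigr => l _; rewrite hornerZ.
Qed.

Let taylorE n i j t :
  (taylor n i j).[t] = series (fun k => ((t *: Q) ^+ k) i j / k`!%:R) n.
Proof.
rewrite horner_poly /series /= big_mkord; apply: eq_bigr => k _.
by rewrite exprmxZ mxE mulrC mulrA.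
Qed.

Let c : R := \sum_i \sum_j `|Q i j|.

(** Induction on n: by the backward equation, the derivative of remainder n + 1 is Q times remainder
    n, since differentiating the Taylor polynomial lowers its order by one in the same way.
    Integrating the bound from 0 gives the next one. *)
Lemma semigroup_taylor n i j (t : R) : 0 <= t ->
  `|p t i j - (taylor n i j).[t]| <= (c * t) ^+ n / n`!%:R.
Proof.
have c0 : 0 <= c by rewrite sumr_ge0// => ? _; exact: sumr_ge0.
have p0 : p 0 = 1%:M by case: Hp.
elim: n i j t => [|n IH] i j t t0.
  rewrite expr0 fact0 divr1 /taylor poly_def big_ord0 horner0 subr0.
  exact: semigroup_norm_le1.
(* [g'] bounds the derivative of the remainder; [q] is its antiderivative vanishing at 0, which is
   the bound claimed at n + 1. *)
pose g' (x : R) : R := c * ((c * x) ^+ n / n`!%:R).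
pose q : {poly R} := (c ^+ n.+1 / n.+1`!%:R) *: 'X^(n.+1).
have qE x : q.[x] = (c * x) ^+ n.+1 / n.+1`!%:R.
  by rewrite hornerZ hornerXn exprMn mulrAC.
rewrite -qE.
pose f' (x : R) : R := (Q *m p x) i j - (taylor n.+1 i j)^`().[x].
apply: (@ler_norm_derive _ (fun t => p t i j - (taylor n.+1 i j).[t]) (horner q)
  f' g') => //.
- move=> x x0; apply: is_deriveB; first exact: semigroup_is_derive.
- move=> x x0; rewrite (_ : g' x = q^`().[x]); first exact: is_derive_poly.
  rewrite derivZ derivXn hornerZ /= hornerMn hornerXn /g' exprMn factS natrM invfM.
  rewrite -(mulr_natr (x ^+ n)) exprS.
  by move: (n`!%:R^-1) => a; field; rewrite nat1r pnatr_eq0.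
- move=> x x0; rewrite /f' taylor_deriv mxE -sumrB /g'.
  apply: (le_trans (ler_norm_sum _ _ _)).
  apply: (@le_trans _ _ (\sum_l `|Q i l| * ((c * x) ^+ n / n`!%:R))).
    apply: ler_sum => l _; rewrite -mulrBr normrM ler_wpM2l//.
    exact: (IH _ _ _ (ltW x0)).
  rewrite -mulr_suml ler_wpM2r//.
    by rewrite divr_ge0// exprn_ge0// mulr_ge0// ltW.
  by rewrite /c [leRHS](bigD1 i)//= lerDl sumr_ge0// => ? _; exact: sumr_ge0.
- rewrite p0 mxE; apply: cvgB; first exact: semigroup_cvg0.
  by apply: cvg_at_right_filter; exact: continuous_horner.
- by apply: cvg_at_right_filter; exact: continuous_horner.
- rewrite p0 mxE horner_coef0 coef_poly /= expr0 fact0 divr1.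
  rewrite [X in _ - X](_ : _ = (1%:M : 'M[R]_N) i j); last by [].
  by rewrite mxE subrr.
- by rewrite qE mulr0 expr0n mul0r.
Qed.

(** The remainder bound (c t)^n / n! is the general term of a convergent exponential series, so it
    tends to 0. *)
Lemma semigroup_mexp (t : R) : 0 <= t -> p t = mexp (t *: Q).
Proof.
move=> t0; apply/matrixP => i j; rewrite mxE; apply/esym/cvg_lim => //.
apply/cvgrPdist_le => e e0.
have /cvgrPdist_le/(_ _ e0) := @cvg_exp_coeff R (c * t); apply: filterS => n.
rewrite sub0r normrN => le_e; rewrite -taylorE.
apply: le_trans (semigroup_taylor n i j t0) _.
by apply: le_trans le_e; exact: ler_norm.
Qed.

End Semigroup.

(** * Exponentials of the block matrices and of closed sets *)

Lemma big_ord_trans (R : nmodType) n (F : 'I_(n + 1) -> R) :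
  \sum_i F i = \sum_(i < n) F (trans i) + F (Delta n).
Proof. by rewrite big_split_ord big_ord1. Qed.

(** The row of [Qmx B] at the absorbing state is zero, so no path through that state contributes to
    a power between transient states. *)
Lemma mexp_trans (R : realType) n (B : 'M[R]_n) (h : R) i j :
  mexp (h *: Qmx B) (trans i) (trans j) = mexp (h *: B) i j.
Proof.
rewrite !mxE; congr (limn (series _)); apply/funext => k; congr (_ / _).
rewrite !exprmxZ !mxE; congr (_ * _).
elim: k j => [|k IH] j; first by rewrite !expr0 !mxE (inj_eq (@lshift_inj _ _)).
rewrite !exprSr !mxE big_ord_trans [X in _ + X]mulrC /Qmx block_mxEdl mxE mul0r addr0.
by apply: eq_bigr => l _; rewrite IH block_mxEul.
Qed.

(** Vanishing of the block from S to its complement is inherited by every power, hence by each term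
    of the series. *)
Lemma mexp_closed (R : realType) N (A : 'M[R]_N) (S : {set 'I_N}) :
  (forall i j, i \in S -> j \notin S -> A i j = 0) ->
  forall i j, i \in S -> j \notin S -> mexp A i j = 0.
Proof.
move=> A0 i j iS jS; rewrite mxE.
suff Ak k l : l \in S -> (A ^+ k) l j = 0.
  under eq_fun do rewrite (Ak _ _ iS) mul0r.
  rewrite (_ : series _ = fun=> 0); first exact: lim_cst.
  by apply/funext => k; rewrite /series/= big1.
elim: k l => [|k IH] l lS.
  by rewrite expr0 mxE; case: eqVneq => // lj; rewrite -lj lS in jS.
rewrite exprS mxE big1// => r _; have [rS|rS] := boolP (r \in S).
  by rewrite IH// mulr0.
by rewrite A0// mul0r.
Qed.

(** The indicators kill the absorbing state, which lies in both sets; on transient states the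
    exponentials reduce to those of B and the indicators become the diagonal matrices [Hmx]. *)
Lemma mexp_survival_weights (R : realType) n (B : 'M[R]_n)
    (Gamma1 Gamma2 : {set 'I_(n + 1)}) (u v : R) i :
  Delta n \in Gamma1 -> Delta n \in Gamma2 ->
  \sum_j \sum_l (j \notin Gamma2)%:R * (l \notin Gamma1)%:R *
    (mexp (u *: Qmx B) (trans i) j * mexp (v *: Qmx B) j l) =
  (mexp (u *: B) *m Hmx Gamma2 *m mexp (v *: B) *m Hmx Gamma1 *m ones n) i 0.
Proof.
move=> D1 D2; rewrite big_ord_trans [X in _ + X]big1 ?addr0; last first.
  by move=> l _; rewrite D2 !mul0r.
under eq_bigr do rewrite big_ord_trans D1 mulr0 mul0r addr0.
rewrite exchange_big /Hmx !mul_mx_diag mxE; apply: eq_bigr => l _.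
rewrite !mxE mulr1 mulr_suml; apply: eq_bigr => j _.
by rewrite !mexp_trans !mxE; ring.
Qed.

(** * Hitting times and the Markov property of the mixture *)

Section Sigma_path.
Context (R : realType) d (T : measurableType d) (N : nat) (X : R -> T -> 'I_N).

Lemma sigma_pathI I A C :
  sigma_path X I A -> sigma_path X I C -> sigma_path X I (A `&` C).
Proof. exact: (@measurableI _ (g_sigma_algebraType _)). Qed.

Lemma sigma_path_state (I : set R) u j : I u -> sigma_path X I (state_at X u j).
Proof. by move=> Iu; apply: sub_sigma_algebra; exists u, j. Qed.

Lemma sub_sigma_path (I J : set R) : I `<=` J -> sigma_path X I `<=` sigma_path X J.
Proof.
by move=> IJ; apply: sub_sigma_algebra2 => A [u [j [/IJ Iu ->]]]; exists u, j.
Qed.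

Lemma sigma_path_measurable (I : set R) :
  (forall t j, 0 <= t -> measurable (state_at X t j)) ->
  (forall u, I u -> 0 <= u) -> sigma_path X I `<=` measurable.
Proof.
move=> mX I0; apply: smallest_sub; first exact: sigma_algebra_measurable.
by move=> A [u [j [/I0 Iu ->]]]; exact: mX.
Qed.

(** Turns a condition on uncountably many times into a countable one: a path that is in Gamma at
    time u stays there for a while, so it is also there at some rational time. *)
Lemma gt_hitting_timeP (Gamma : {set 'I_N}) (t : R) w :
  right_continuous_process X -> 0 <= t ->
  (t%:E < hitting_time X Gamma w)%E <->
  X t w \notin Gamma /\
    forall q : rat, 0 <= (ratr q : R) < t -> X (ratr q) w \notin Gamma.
Proof.
move=> [_ rX] t0; split => [tG|[Xt Xq]].
  suff H u : 0 <= u <= t -> X u w \notin Gamma.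
    split; first by rewrite H// t0 lexx.
    by move=> q /andP[q0 /ltW qt]; apply: H; rewrite q0.
  move=> /andP[u0 ut]; apply/negP => uG; move: tG; rewrite ltNge => /negP; apply.
  apply: (@le_trans _ _ u%:E); last by rewrite lee_fin.
  by apply: ereal_inf_lbound; exists u.
have [e /= e0 He] := rX w t t0.
(* The path keeps its value X t on [t, t + e), so t + e is a lower bound of the visiting times; this
   makes the inequality strict. *)
apply: (@lt_le_trans _ _ (t + e)%:E); first by rewrite lte_fin ltrDl.
apply: le_ereal_inf_tmp => _ [u [u0 uG] <-]; rewrite lee_fin leNgt.
apply/negP => ute.
have [ut|ut|ut] := ltgtP u t.
- have [e' /= e'0 He'] := rX w u u0.
  (* A rational after u, before t, and close enough to u for the path to be still at X u. *)
  have [q] : exists q : rat, ratr q \in `]u, (Num.min t (u + e'))[.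
    by apply: rat_in_itvoo; rewrite lt_min ut ltrDl.
  rewrite in_itv/= lt_min => /and3P[uq qt que].
  have := Xq q; rewrite qt (le_trans u0 (ltW uq)) => /(_ isT).
  rewrite (He' (ratr q)) ?uG//=.
  by rewrite ltr0_norm ?subr_lt0// opprB ltrBlDl.
- move: Xt; rewrite -(He u) ?uG//=.
  by rewrite ltr0_norm ?subr_lt0// opprB ltrBlDl.
- by move: Xt; rewrite -ut uG.
Qed.

End Sigma_path.

Section Mixture.
Context (R : realType) d (T : measurableType d) (P : probability T R) (n m : nat).
Context (B : 'I_m -> 'M[R]_n) (p0 : 'I_n -> R) (s0 : 'I_m -> 'I_n -> R).
Context (phi : T -> 'I_m) (X : R -> T -> 'I_(n + 1)).
Hypothesis mixX : markov_mixture P B p0 s0 phi X.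

Let pr A : R := fine (P A).

Let mX (t : R) j : 0 <= t -> measurable (state_at X t j).
Proof. by case: (mix_right_continuous mixX) => + _; apply. Qed.

Let regime k := [set w | phi w = k].

Let mphi k : measurable (regime k).
Proof. exact: (mix_phi_measurable mixX). Qed.

Lemma fine_prob_partition N (f : T -> 'I_N) A :
  (forall j, measurable [set w | f w = j]) -> measurable A ->
  fine (P A) = \sum_j fine (P (A `&` [set w | f w = j])).
Proof.
move=> mf mA.
have mAf j : measurable (A `&` [set w | f w = j]) by exact: measurableI.
rewrite sum_fine; last by move=> j _; exact: fin_num_measure.
congr fine; rewrite -measure_semi_additive_ord//.
- congr (P _); apply/seteqP; split => w.
    move=> Aw; rewrite -bigcup_seq; exists (f w) => //=; exact: mem_index_enum.
  by rewrite -bigcup_seq => -[j _ []].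
- by move=> i j _ _ [w [[_ <-] [_ <-]]].
- exact: bigsetU_measurable.
Qed.

Let pr0S A C : measurable A -> measurable C -> A `<=` C -> pr C = 0 -> pr A = 0.
Proof.
move=> mA mC AC /eqP; rewrite /pr fine_eq0 ?fin_num_measure// => /eqP C0.
by rewrite (subset_measure0 mA mC AC C0).
Qed.

Let sigma_path_past t A : sigma_path X [set u | 0 <= u <= t] A -> measurable A.
Proof. by apply: sigma_path_measurable => // u /= /andP[]. Qed.

(** The Markov property is assumed given both regime and initial state. The transition matrix
    [mexp (h *: Qmx (B k))] is the same for all initial states, so summing over them leaves
    conditioning on the regime alone. *)
Lemma mixture_step k (s h : R) j l A : 0 <= s -> 0 <= h ->
  sigma_path X [set u | 0 <= u <= s] A ->
  pr (A `&` state_at X s j `&` regime k `&` state_at X (s + h) l) =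
  pr (A `&` state_at X s j `&` regime k) * mexp (h *: Qmx (B k)) j l.
Proof.
move=> s_ge0 h_ge0 sA; have mA := sigma_path_past sA.
have mj : measurable (state_at X s j) by exact: mX.
have ml : measurable (state_at X (s + h) l) by apply: mX; exact: addr_ge0.
have mk := mphi k.
rewrite /pr (@fine_prob_partition _ (X 0))//; first last.
- by repeat (apply: measurableI => //).
- by move=> i; exact: mX.
rewrite [in RHS](@fine_prob_partition _ (X 0))//; first last.
- by repeat (apply: measurableI => //).
- by move=> i; exact: mX.
rewrite mulr_suml; apply: eq_bigr => i _.
have m0 : measurable [set w | X 0 w = i] by exact: mX.
set C := state_at X 0 i `&` regime k.
rewrite [Z in fine (P Z) = _](_ : _ =
  A `&` state_at X s j `&` C `&` state_at X (s + h) l);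
  last by apply/seteqP; split => w; rewrite /C /state_at /regime /=; tauto.
rewrite [Z in _ = fine (P Z) * _](_ : _ = A `&` state_at X s j `&` C);
  last by apply/seteqP; split => w; rewrite /C /state_at /regime /=; tauto.
have mC : measurable (A `&` state_at X s j `&` C) by repeat (apply: measurableI => //).
(* If the conditioning event is null, both sides are 0. *)
have [C0|C0] := eqVneq (P (A `&` state_at X s j `&` C)) 0%E.
  rewrite [Z in fine Z = _](subset_measure0 _ mC _ C0) ?C0 ?mul0r//.
  exact: measurableI.
(* Starting at the absorbing state has probability 0, so the initial state is transient here. *)
move: C0 mC; rewrite /C -[i]fintype.splitK.
case: (fintype.split i) => i' /= C0' mC; last first.
  exfalso; move/eqP: C0'; apply.
  apply: (subset_measure0 _ _ _ (mix_init_Delta mixX)) => //.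
  - exact: mX.
  - by move=> w [_ [+ _]]; rewrite /= ord1.
have [p Qp /(_ s h j l A s_ge0 h_ge0 sA C0')] := mix_markov mixX k i'.
rewrite /cprob (semigroup_mexp Qp h_ge0) setIC => <-.
by rewrite mulrC divfK// fine_eq0 ?fin_num_measure.
Qed.

(** [mixture_step] from t to u with the past A, then from u to v with the past A and X_t = i. *)
Lemma mixture_two_steps k (t u v : R) i j l A : 0 <= t -> t <= u -> u <= v ->
  sigma_path X [set r | 0 <= r <= t] A ->
  pr (A `&` regime k `&` state_at X t i `&` state_at X u j `&` state_at X v l) =
  pr (regime k `&` state_at X t i `&` A) *
    (mexp ((u - t) *: Qmx (B k)) i j * mexp ((v - u) *: Qmx (B k)) j l).
Proof.
move=> t0 tu uv sA.
have st : sigma_path X [set r | 0 <= r <= u] (A `&` state_at X t i).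
  apply: sigma_pathI; last by apply: sigma_path_state; rewrite /= t0.
  by move: sA; apply: sub_sigma_path => r /= /andP[-> /le_trans]; apply.
have := mixture_step k i j t0 (_ : 0 <= u - t) sA.
have := mixture_step k j l (le_trans t0 tu) (_ : 0 <= v - u) st.
rewrite !subr_ge0 !subrKC => /(_ uv) E1 /(_ tu) E2.
rewrite mulrA [Z in pr Z * _](_ : _ = A `&` state_at X t i `&` regime k); last first.
  by apply/seteqP; split => w; rewrite /regime /state_at /=; tauto.
rewrite -E2 [Z in _ = pr Z * _](_ : _ =
  A `&` state_at X t i `&` state_at X u j `&` regime k); last first.
  by apply/seteqP; split => w; rewrite /regime /state_at /=; tauto.
rewrite -E1; congr pr.
by apply/seteqP; split => w; rewrite /regime /state_at /=; tauto.
Qed.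

Let mstates (Gamma : {set 'I_(n + 1)}) (t : R) : 0 <= t ->
  measurable [set w | X t w \in Gamma].
Proof.
move=> t0; rewrite (_ : [set w | _] = \bigcup_(j in [set` Gamma]) state_at X t j).
  by apply: fin_bigcup_measurable => // j _; exact: mX.
by apply/seteqP; split => [w /= h|w [j /= jG ->]//]; exists (X t w).
Qed.

Let mstatesC (Gamma : {set 'I_(n + 1)}) (t : R) : 0 <= t ->
  measurable [set w | X t w \notin Gamma].
Proof.
move=> t0; rewrite (_ : [set w | _] = ~` [set w | X t w \in Gamma]).
  by apply: measurableC; exact: mstates.
by apply/seteqP; split => w /= /negP.
Qed.

(** Split by X_u, X_v and the regime: each piece is either empty or carries as a factor an
    exponential entry leading out of the closed set, which is 0. *)
Lemma closed_escape_null (Gamma : {set 'I_(n + 1)}) (u v : R) :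
  stoch_closed B Gamma -> 0 <= u -> u <= v ->
  P ([set w | X u w \in Gamma] `&` [set w | X v w \notin Gamma]) = 0%E.
Proof.
move=> clG u0 uv; have v0 := le_trans u0 uv.
have mV : measurable [set w | X v w \notin Gamma] by exact: mstatesC.
have mS : measurable ([set w | X u w \in Gamma] `&` [set w | X v w \notin Gamma]).
  by apply: measurableI => //; exact: mstates.
have mXu j : measurable [set w | X u w = j] by exact: mX.
have mXv j : measurable [set w | X v w = j] by exact: mX.
apply/eqP; rewrite -fine_eq0 ?fin_num_measure//; apply/eqP.
rewrite (fine_prob_partition mXu)// big1// => j _.
have mSj := measurableI _ _ mS (mXu j).
rewrite (fine_prob_partition mXv)// big1// => l _.
have mSjl := measurableI _ _ mSj (mXv l).
rewrite (fine_prob_partition mphi)// big1// => k _.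
have [jG|jG] := boolP (j \in Gamma); last first.
  rewrite [Z in P Z](_ : _ = set0) ?measure0//.
  by apply/seteqP; split => // w [[[[/= h _] wj] _] _]; rewrite -wj h in jG.
have [lG|lG] := boolP (l \in Gamma).
  rewrite [Z in P Z](_ : _ = set0) ?measure0//.
  by apply/seteqP; split => // w [[[[_ /= h] _] wl] _]; rewrite -wl (negbTE h) in lG.
apply: (@pr0S _ (setT `&` state_at X u j `&` regime k `&` state_at X (u + (v - u)) l)).
- by apply: measurableI => //; exact: mphi.
- rewrite subrKC; apply: measurableI; last exact: mX.
  by apply: measurableI; [rewrite setTI; exact: mX|exact: mphi].
- by move=> w [[[_ ?] ?] ?]; rewrite subrKC.
- rewrite mixture_step ?subr_ge0//; last first.
    exact: (@measurableT _ (g_sigma_algebraType _)).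
  rewrite (mexp_closed _ jG lG) ?mulr0// => a b aG bG.
  by rewrite mxE clG// mulr0.
Qed.

(** N collects the paths in Gamma at some rational time before t. Each such time contributes only a
    null set to the paths outside Gamma at t, and there are countably many. *)
Lemma survival_set (Gamma : {set 'I_(n + 1)}) (t : R) :
  stoch_closed B Gamma -> 0 <= t ->
  exists2 N, measurable N &
    [set w | (t%:E < hitting_time X Gamma w)%E] = [set w | X t w \notin Gamma] `\` N /\
    P.-negligible ([set w | X t w \notin Gamma] `&` N).
Proof.
move=> clG t0.
(* Enumerates the rationals. Codes of no rational give time 0, itself a rational time; the guard in
   [Nk] discards it when t = 0. *)
pose q k : R := ratr (odflt 0 (unpickle k : option rat)).
pose Nk k := if 0 <= q k < t then [set w | X (q k) w \in Gamma] else set0.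
exists (\bigcup_k Nk k).
  apply: bigcupT_measurable => k; rewrite /Nk; case: ifP => // /andP[q0 _].
  exact: mstates.
split.
  apply/seteqP; split => w /=.
    move/(gt_hitting_timeP _ _ (mix_right_continuous mixX) t0) => [Xt Xq].
    split => //; case=> k _; rewrite /Nk; case: ifP => // /Xq; rewrite -/(q k) /=.
    by move=> /negP.
  move=> [Xt NN]; apply/(gt_hitting_timeP _ _ (mix_right_continuous mixX) t0).
  split => // r rt; apply/negP => rG; apply: NN; exists (pickle r) => //.
  by rewrite /Nk /q pickleK /= rt.
rewrite setI_bigcupr; apply: negligible_bigcup => k.
rewrite /Nk; case: ifP => [/andP[q0 /ltW qt]|_]; last first.
  by rewrite setI0; exact: negligible_set0.
apply/negligibleP; last by rewrite setIC; exact: closed_escape_null.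
apply: measurableI; [exact: mstatesC|exact: mstates].
Qed.

Lemma measurable_survival (Gamma : {set 'I_(n + 1)}) (t : R) :
  stoch_closed B Gamma -> 0 <= t ->
  measurable [set w | (t%:E < hitting_time X Gamma w)%E].
Proof.
move=> clG t0; have [N mN [-> _]] := survival_set clG t0.
by apply: measurableD => //; exact: mstatesC.
Qed.

(** Up to a null set, survival means X_t1 outside Gamma1 and X_t2 outside Gamma2. Partitioning by
    the regime and the states at t, t2 and t1 makes each piece a two-step probability. *)
Lemma survival_prob (Gamma1 Gamma2 : {set 'I_(n + 1)}) (t t1 t2 : R) C :
  stoch_closed B Gamma1 -> stoch_closed B Gamma2 ->
  Delta n \in Gamma1 -> Delta n \in Gamma2 ->
  0 <= t -> t <= t2 -> t2 <= t1 ->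
  sigma_path X [set u | 0 <= u < t] C ->
  pr (joint_survival X Gamma1 Gamma2 t1 t2 `&` C) =
  \sum_k \sum_i pr (regime k `&` state_at X t (trans i) `&` C) *
    (mexp ((t2 - t) *: B k) *m Hmx Gamma2 *m mexp ((t1 - t2) *: B k)
       *m Hmx Gamma1 *m ones n) i 0.
Proof.
move=> cl1 cl2 D1 D2 t_ge0 tt2 tt1.
have t2_ge0 := le_trans t_ge0 tt2; have t1_ge0 := le_trans t2_ge0 tt1.
(* The Markov property takes pasts that include time t, so the strict past is enlarged. *)
move=> /(@sub_sigma_path _ _ _ _ _ _ [set u | 0 <= u <= t]) sC.
have {}sC : sigma_path X [set u | 0 <= u <= t] C.
  by apply: sC => u /= /andP[-> /ltW].
have mC := sigma_path_past sC.
have [N1 mN1 [E1 N10]] := survival_set cl1 t1_ge0.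
have [N2 mN2 [E2 N20]] := survival_set cl2 t2_ge0.
pose V1 := [set w | X t1 w \notin Gamma1]; pose V2 := [set w | X t2 w \notin Gamma2].
have mV1 : measurable V1 by exact: mstatesC.
have mV2 : measurable V2 by exact: mstatesC.
have mV : measurable (V1 `&` V2 `&` C) by do 2?apply: measurableI.
transitivity (pr (V1 `&` V2 `&` C)).
  rewrite /pr (measureDI P mV (measurableU _ _ mN1 mN2)).
  rewrite [Z in _ = fine (_ + Z)](_ : _ = 0%E) ?adde0.
    congr (fine (P _)).
    rewrite (_ : joint_survival _ _ _ _ _ =
      [set w | (t1%:E < hitting_time X Gamma1 w)%E]
      `&` [set w | (t2%:E < hitting_time X Gamma2 w)%E])// E1 E2.
    by apply/seteqP; split => w; rewrite /V1 /V2 /=; tauto.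
  apply/negligibleP; first by apply: measurableI => //; exact: measurableU.
  apply: negligibleS (negligibleU N10 N20).
  by move=> w; rewrite /V1 /V2 /=; tauto.
rewrite /pr (fine_prob_partition mphi)//; apply: eq_bigr => k _.
have mXt i : measurable [set w | X t w = i] by exact: mX.
have mXt1 i : measurable [set w | X t1 w = i] by exact: mX.
have mXt2 i : measurable [set w | X t2 w = i] by exact: mX.
have mVk := measurableI _ _ mV (mphi k).
transitivity (\sum_i \sum_j \sum_l (j \notin Gamma2)%:R * (l \notin Gamma1)%:R *
    (pr (regime k `&` state_at X t i `&` C) *
      (mexp ((t2 - t) *: Qmx (B k)) i j * mexp ((t1 - t2) *: Qmx (B k)) j l))).
  rewrite (fine_prob_partition mXt)//; apply: eq_bigr => i _.
  have mVki := measurableI _ _ mVk (mXt i).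
  rewrite (fine_prob_partition mXt2)//; apply: eq_bigr => j _.
  have mVkij := measurableI _ _ mVki (mXt2 j).
  rewrite (fine_prob_partition mXt1)//; apply: eq_bigr => l _.
  have [jG|jG] := boolP (j \in Gamma2).
    rewrite !mul0r [Z in P Z](_ : _ = set0) ?measure0//.
    apply/seteqP; split => // w /=; rewrite /V2 /=.
    by move=> -[[[[[[_ /negP h] _] _] _] wj] _]; rewrite wj in h.
  have [lG|lG] := boolP (l \in Gamma1).
    rewrite !(mul0r, mulr0) [Z in P Z](_ : _ = set0) ?measure0//.
    apply/seteqP; split => // w /=; rewrite /V1 /=.
    by move=> -[[[[[[/negP h _] _] _] _] _] wl]; rewrite wl in h.
  rewrite mulr1 mul1r -mixture_two_steps//; congr (fine (P _)).
  apply/seteqP; split => w; rewrite /V1 /V2 /regime /state_at /=; first by tauto.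
  by move=> [[[[? ?] ?] w2] w1]; rewrite w1 w2; tauto.
(* The term with X_t absorbed vanishes: no state outside the closed set Gamma2 is reached from
   [Delta n]. *)
rewrite big_ord_trans [X in _ + X]big1 ?addr0; last first.
  move=> j _; rewrite big1// => l _.
  have [jG|jG] := boolP (j \in Gamma2); first by rewrite !mul0r.
  rewrite (mexp_closed _ D2 jG) ?mul0r ?mulr0// => a b aG bG.
  by rewrite mxE cl2// mulr0.
apply: eq_bigr => i _; rewrite -mexp_survival_weights//.
rewrite mulr_sumr; apply: eq_bigr => j _; rewrite mulr_sumr; apply: eq_bigr => l _.
by rewrite mulrCA.
Qed.

End Mixture.

(** * Versions of conditional probabilities *)

Section Density.
Context (R : realType) d (T : measurableType d) (P : probability T R).
Variable F : set (set T).
Hypothesis sigmaF : sigma_algebra setT F.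
Hypothesis Fm : F `<=` measurable.

(** Z is an F-measurable density of nu with respect to P on F. Allowing any set function nu makes
    linear combinations direct; a conditional probability of A is the case nu C = P(A ∩ C). *)
Definition has_density (nu : set T -> R) (Z : T -> R) :=
  [/\ forall U : set R, measurable U -> F (Z @^-1` U),
      P.-integrable setT (EFin \o Z)
    & forall C, F C -> (\int[P]_(w in C) (Z w)%:E = (nu C)%:E)%E].

(** Links preimages lying in F to measurability for the generated sigma-algebra, so that closure
    properties of measurable functions apply. *)
Let measurable_funF (Z : T -> R) :
  (forall U : set R, measurable U -> F (Z @^-1` U)) <->
  measurable_fun setT (Z : g_sigma_algebraType F -> R).
Proof.
have FE : <<s F >> = F by exact: sigma_algebra_id.
split=> [mZ _ U mU|mZ U mU].
  by rewrite setTI /measurable/= FE; exact: mZ.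
by have := mZ measurableT U mU; rewrite setTI /measurable/= FE.
Qed.

Lemma cond_prob_density A Y : measurable A -> cond_prob P F A Y ->
  has_density (fun C => fine (P (A `&` C))) Y.
Proof.
move=> mA [mY iY YE]; split => // C FC; rewrite YE// fineK// fin_num_measure//.
by apply: measurableI => //; exact: Fm.
Qed.

Lemma has_densityZ c nu Z : has_density nu Z ->
  has_density (fun C => c * nu C) (fun w => c * Z w).
Proof.
move=> [/measurable_funF mZ iZ ZE]; split.
- by apply/measurable_funF; exact: measurable_funM.
- exact: (integrableZl measurableT c iZ).
- move=> C FC; under eq_integral do rewrite EFinM.
  rewrite integralZl ?ZE//; first exact: Fm.
  by apply: integrableS iZ => //; exact: Fm.
Qed.

Lemma has_densityD nu1 nu2 Z1 Z2 : has_density nu1 Z1 -> has_density nu2 Z2 ->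
  has_density (fun C => nu1 C + nu2 C) (fun w => Z1 w + Z2 w).
Proof.
move=> [/measurable_funF mZ1 iZ1 Z1E] [/measurable_funF mZ2 iZ2 Z2E]; split.
- by apply/measurable_funF; exact: measurable_funD.
- exact: (integrableD measurableT iZ1 iZ2).
- move=> C FC; under eq_integral do rewrite EFinD.
  have mC := Fm FC.
  rewrite integralD//; last 2 first.
    by apply: integrableS iZ1.
    by apply: integrableS iZ2.
  by rewrite Z1E// Z2E.
Qed.

Lemma has_density0 : has_density (fun=> 0) (fun=> 0).
Proof.
split; first by apply/measurable_funF; exact: measurable_cst.
  exact: integrable0.
by move=> C FC; rewrite integral0.
Qed.

Lemma has_density_sum (I : finType) (nu : I -> set T -> R) (Z : I -> T -> R) :
  (forall i, has_density (nu i) (Z i)) ->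
  has_density (fun C => \sum_i nu i C) (fun w => \sum_i Z i w).
Proof.
move=> dZ; elim: (index_enum I) => [|i r IH].
  under [X in has_density X]eq_fun do rewrite big_nil.
  under [X in has_density _ X]eq_fun do rewrite big_nil.
  exact: has_density0.
under [X in has_density X]eq_fun do rewrite big_cons.
under [X in has_density _ X]eq_fun do rewrite big_cons.
exact: has_densityD.
Qed.

(** The set where Z2 < Z1 belongs to F. There Z1 - Z2 is positive but its integral is at most 0, so
    the set is null. *)
Lemma has_density_le nu1 nu2 Z1 Z2 : has_density nu1 Z1 -> has_density nu2 Z2 ->
  (forall C, F C -> nu1 C <= nu2 C) -> {ae P, forall w, Z1 w <= Z2 w}.
Proof.
move=> [mZ1 iZ1 Z1E] [mZ2 iZ2 Z2E] le_nu.
pose C := [set w | Z2 w < Z1 w].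
have FC : F C.
  have mlt := measurable_fun_ltr (iffLR (measurable_funF _) mZ2)
    (iffLR (measurable_funF _) mZ1).
  have := mlt measurableT [set true] I.
  by rewrite setTI /measurable/= sigma_algebra_id.
have mC := Fm FC.
have iC1 : P.-integrable C (EFin \o Z1) by apply: integrableS iZ1.
have iC2 : P.-integrable C (EFin \o Z2) by apply: integrableS iZ2.
have : (\int[P]_(w in C) `|(EFin \o Z1) w - (EFin \o Z2) w| = 0)%E.
  apply/eqP; rewrite eq_le integral_ge0 ?andbT//.
  rewrite (@eq_integral _ _ _ _ _
    (fun w => (EFin \o Z1) w - (EFin \o Z2) w)%E); last first.
    move=> w; rewrite inE => Cw; rewrite gee0_abs//= -EFinB lee_fin subr_ge0.
    exact: ltW.
  by rewrite integralB// Z1E// Z2E// -EFinB lee_fin subr_le0 le_nu.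
move/(ae_eq_integral_abs P mC) => /(_ (measurable_int _ (integrableB mC iC1 iC2))).
apply: filterS => w /= CE; rewrite leNgt; apply/negP => Cw.
by have /eqP := CE Cw; rewrite -EFinB eqe subr_eq0 => /eqP E; rewrite /C/= E ltxx in Cw.
Qed.

Lemma has_density_unique nu Z1 Z2 : has_density nu Z1 -> has_density nu Z2 ->
  {ae P, forall w, Z1 w = Z2 w}.
Proof.
move=> d1 d2; have le12 := has_density_le d1 d2 (fun C _ => lexx _).
have le21 := has_density_le d2 d1 (fun C _ => lexx _).
by apply: filterS2 le12 le21 => w w12 w21; apply/eqP; rewrite eq_le w12.
Qed.

End Density.

(** * The conditional survival function given the information *)

Section Conditional_survival.
Context (R : realType) d (T : measurableType d) (P : probability T R) (n m : nat).
Context (B : 'I_m -> 'M[R]_n) (p0 : 'I_n -> R) (s0 : 'I_m -> 'I_n -> R).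
Context (phi : T -> 'I_m) (X : R -> T -> 'I_(n + 1)).
Hypothesis mixX : markov_mixture P B p0 s0 phi X.
Context (t : R) (t_ge0 : 0 <= t) (F : set (set T)).
Hypothesis sigmaF : sigma_algebra setT F.
Hypothesis F_past : F `<=` sigma_path X [set u | 0 <= u < t].

Let mX (u : R) j : 0 <= u -> measurable (state_at X u j).
Proof. by case: (mix_right_continuous mixX) => + _; apply. Qed.

Let Fm : F `<=` measurable.
Proof.
apply: (subset_trans F_past); apply: sigma_path_measurable => [u j|u /= /andP[]//].
exact: mX.
Qed.

(** Multiplying s = q / p by the denominator recovers q. Where p vanishes, 0 <= q <= p almost surely
    forces q = 0, so the identity holds there too. *)
Lemma regime_density k i (s r : T -> R) :
  cond_prob_given P F (state_at X t (trans i)) [set w | phi w = k] s ->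
  has_density P F (fun C => fine (P (state_at X t (trans i) `&` C))) r ->
  exists2 q,
    has_density P F
      (fun C => fine (P ([set w | phi w = k] `&` state_at X t (trans i) `&` C))) q &
    {ae P, forall w, r w * s w = q w}.
Proof.
move=> [q [p [qE pE sE]]] rE; exists q.
  apply: (cond_prob_density Fm) qE; apply: measurableI; last exact: mX.
  exact: (mix_phi_measurable mixX).
have mi : measurable (state_at X t (trans i)) by exact: mX.
have mki : measurable ([set w | phi w = k] `&` state_at X t (trans i)).
  by apply: measurableI => //; exact: (mix_phi_measurable mixX).
have dp := cond_prob_density Fm mi pE.
have dq := cond_prob_density Fm mki qE.
have d0 := has_density0 P sigmaF.
have rp := has_density_unique sigmaF Fm rE dp.
have q_ge0 := has_density_le sigmaF Fm d0 dq (fun C _ => fine_ge0 (measure_ge0 _ _)).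
have q_le : {ae P, forall w, q w <= p w}.
  apply: (has_density_le sigmaF Fm dq dp) => C /Fm mC.
  rewrite fine_le ?fin_num_measure//; [exact: measurableI|exact: measurableI|].
  by apply: le_measure; rewrite ?inE; [exact: measurableI..|move=> w [[_ ?]]].
apply: filterS3 sE rp (filterI q_ge0 q_le) => w sw -> [q0 qp].
have [p0'|p0'] := ltP 0 (p w); first by rewrite sw// mulrC divfK// gt_eqF.
have pw : p w = 0 by apply/eqP; rewrite eq_le p0' (le_trans q0 qp).
by apply/eqP; rewrite pw mul0r eq_le q0 -pw.
Qed.

(** Write every conditional probability as an F-density over the common denominator [c]; the formula
    then reduces to [survival_prob] and almost sure uniqueness of densities. *)
Lemma conditional_survival (Gamma1 Gamma2 : {set 'I_(n + 1)})
    (b : bool) (pit : 'I_n -> T -> R) (s : 'I_m -> 'I_n -> T -> R)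
    (palive Fbar : T -> R) (t1 t2 : R) :
  stoch_closed B Gamma1 -> stoch_closed B Gamma2 ->
  Delta n \in Gamma1 -> Delta n \in Gamma2 ->
  (forall i, cond_prob_opt P F b (alive X t) (state_at X t (trans i)) (pit i)) ->
  (forall k i, cond_prob_given P F (state_at X t (trans i))
                 [set w | phi w = k] (s k i)) ->
  cond_prob P F (alive X t) palive ->
  t <= t2 -> t2 <= t1 ->
  cond_prob_opt P F b (alive X t) (joint_survival X Gamma1 Gamma2 t1 t2) Fbar ->
  {ae P, forall w, b ==> (0 < palive w) ->
    Fbar w =
      (\sum_k (\row_i pit i w) *m diag_mx (\row_i s k i w)
         *m mexp ((t2 - t) *: B k) *m Hmx Gamma2
         *m mexp ((t1 - t2) *: B k) *m Hmx Gamma1 *m ones n) 0 0}.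
Proof.
move=> cl1 cl2 D1 D2 pitE sE paliveE tt2 tt1 FbarE.
set A := joint_survival X Gamma1 Gamma2 t1 t2.
pose M k := mexp ((t2 - t) *: B k) *m Hmx Gamma2 *m mexp ((t1 - t2) *: B k)
  *m Hmx Gamma1 *m ones n.
have mA : measurable A.
  have t2_ge0 := le_trans t_ge0 tt2.
  by apply: measurableI; apply: (measurable_survival mixX) => //; exact: le_trans tt1.
have mi i : measurable (state_at X t (trans i)) by exact: mX.
have malive : measurable (alive X t).
  rewrite (_ : alive X t = ~` state_at X t (Delta n)); first exact/measurableC/mX.
  by apply/seteqP; split => w /= /eqP.
have alive_state i : state_at X t (trans i) `&` alive X t = state_at X t (trans i).
  apply/setIidl => w; rewrite /alive/state_at/= => ->.
  by rewrite /trans /Delta eq_lrshift.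
(* Absorption at t would put X_t in Gamma1, giving tau_1 <= t <= t1 and contradicting survival. *)
have alive_A : A `&` alive X t = A.
  apply/setIidl => w -[w1 _]; apply/negP => /eqP wD.
  move: w1; rewrite ltNge => /negP; apply; apply: (@le_trans _ _ t%:E).
    by apply: ereal_inf_lbound; exists t; rewrite //= wD.
  by rewrite lee_fin (le_trans tt2).
have dalive := cond_prob_density Fm malive paliveE.
pose c w := if b then palive w else 1.
(* The two meanings of G_t are treated at once: for an event contained in survival up to t,
   conditioning on G_t is conditioning on F followed by division by [c]. *)
have normalize E Y : measurable E -> E `&` alive X t = E ->
    cond_prob_opt P F b (alive X t) E Y -> exists r,
    has_density P F (fun C => fine (P (E `&` C))) r /\
    {ae P, forall w, b ==> (0 < palive w) -> Y w = r w / c w}.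
  move=> mE Ealive; rewrite /cond_prob_opt /c.
  clear c pitE FbarE; case: b => [[r [p [rE pE YE]]]|YE]; last first.
    exists Y; split; first exact: cond_prob_density YE.
    by apply: aeW => w _; rewrite divr1.
  exists r; split; first by rewrite Ealive in rE; exact: cond_prob_density rE.
  have pp := has_density_unique sigmaF Fm dalive (cond_prob_density Fm malive pE).
  by apply: filterS2 YE pp => w YE ->.
have /choice [r rE] i := normalize _ _ (mi i) (alive_state i) (pitE i).
have [Y [dY FbarY]] := normalize _ _ mA alive_A FbarE.
have /choice [q qE] (ki : 'I_m * 'I_n) : exists q,
    has_density P F (fun C => fine (P ([set w | phi w = ki.1] `&`
      state_at X t (trans ki.2) `&` C))) q /\
    {ae P, forall w, r ki.2 w * s ki.1 ki.2 w = q w}.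
  have [q dq qE] := regime_density (sE ki.1 ki.2) (rE ki.2).1.
  by exists q.
(* By [survival_prob], this combination of the densities of {phi = k, X_t = i} is a version of the
   probability of A given F. *)
have dS : has_density P F (fun C => fine (P (A `&` C)))
    (fun w => \sum_k \sum_i M k i 0 * q (k, i) w).
  suff [m1 m2 m3] : has_density P F (fun C => \sum_k \sum_i M k i 0 *
      fine (P ([set w | phi w = k] `&` state_at X t (trans i) `&` C)))
      (fun w => \sum_k \sum_i M k i 0 * q (k, i) w).
    split => // C FC; rewrite m3//; congr EFin.
    rewrite (survival_prob mixX cl1 cl2 D1 D2 t_ge0 tt2 tt1 (F_past FC)).
    by apply: eq_bigr => k _; apply: eq_bigr => i _; rewrite mulrC.
  apply: (has_density_sum sigmaF Fm) => k; apply: (has_density_sum sigmaF Fm) => i.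
  exact: (has_densityZ sigmaF Fm _ (qE (k, i)).1).
have YS := has_density_unique sigmaF Fm dY dS.
have rs : {ae P, forall w, forall ki, r ki.2 w * s ki.1 ki.2 w = q ki w}.
  (* There are finitely many pairs (k, i), so one null set serves for all. *)
  by apply: filter_forall => ki; exact: (qE ki).2.
have pr : {ae P, forall w, forall i, b ==> (0 < palive w) -> pit i w = r i w / c w}.
  by apply: filter_forall => i; exact: (rE i).2.
apply: filterS3 FbarY YS (filterI rs pr) => w FbarY' YS' [rs' pr'] bw.
rewrite FbarY'// YS' summxE mulr_suml; apply: eq_bigr => k _.
rewrite [in RHS](_ : _ *m ones n =
  (\row_i pit i w) *m (diag_mx (\row_i s k i w) *m M k));
  last by rewrite /M !mulmxA.
rewrite [RHS]mxE mulr_suml; apply: eq_bigr => i _; move: (M k) => v.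
by rewrite mul_diag_mx !mxE pr'// -rs'/=; ring.
Qed.

End Conditional_survival.

Theorem proposition3p8 (R : realType) (d : measure_display)
    (T : measurableType d) (P : probability T R) (n m : nat)
    (B : 'I_m -> 'M[R]_n) (p0 : 'I_n -> R) (s0 : 'I_m -> 'I_n -> R)
    (phi : T -> 'I_m) (X : R -> T -> 'I_(n + 1))
    (Gamma1 Gamma2 : {set 'I_(n + 1)})
    (mixX : markov_mixture P B p0 s0 phi X)
    (closed1 : stoch_closed B Gamma1) (closed2 : stoch_closed B Gamma2)
    (capGamma : (Gamma1 :&: Gamma2 = [set Delta n])%SET)
    (p0_neq0 : forall i : 'I_n,
       trans i \notin Gamma1 -> trans i \notin Gamma2 -> p0 i != 0)
    (tau_gt0 : P (joint_survival X Gamma1 Gamma2 0 0) = 1%E)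
    (t : R) (t_ge0 : 0 <= t)
    (* the information F_{t-} *)
    (F : set (set T)) (sigmaF : sigma_algebra setT F)
    (F_past : F `<=` sigma_path X [set u | 0 <= u < t])
    (* whether the event X_t != Delta is part of the information G_t *)
    (b : bool)
    (pit : 'I_n -> T -> R)
    (pitE : forall i,
       cond_prob_opt P F b (alive X t) (state_at X t (trans i)) (pit i))
    (s : 'I_m -> 'I_n -> T -> R) (sE : regime_weights P phi X t F s)
    (palive : T -> R) (paliveE : cond_prob P F (alive X t) palive)
    (t1 t2 : R) (Fbar : T -> R)
    (FbarE : cond_prob_opt P F b (alive X t)
               (joint_survival X Gamma1 Gamma2 t1 t2) Fbar) :
  let pirow w : 'rV[R]_n := \row_i pit i w in
  let S k w : 'M[R]_n := diag_mx (\row_i s k i w) in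
  (* the quantities conditioned on G_t are defined at w *)
  let defined w : bool := b ==> (0 < palive w) in
  (t <= t2 -> t2 <= t1 ->
     {ae P, forall w, defined w ->
        Fbar w =
          (\sum_k pirow w *m S k w *m mexp ((t2 - t) *: B k) *m Hmx Gamma2
                  *m mexp ((t1 - t2) *: B k) *m Hmx Gamma1 *m ones n) 0 0}) /\
  (t <= t1 -> t1 <= t2 ->
     {ae P, forall w, defined w ->
        Fbar w =
          (\sum_k pirow w *m S k w *m mexp ((t1 - t) *: B k) *m Hmx Gamma1
                  *m mexp ((t2 - t1) *: B k) *m Hmx Gamma2 *m ones n) 0 0}).
Proof.
  move=> pirow S defined.
  have : Delta n \in Gamma1 :&: Gamma2 by rewrite capGamma finset.in_set1.
  rewrite finset.in_setI => /andP[D1 D2].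
  case: sE => sE _; split => tt1 tt2.
    exact: (conditional_survival mixX t_ge0 sigmaF F_past).
  (* The second case is the first with the indices 1 and 2 exchanged; the event is the same
     intersection in the other order. *)
  apply: (conditional_survival mixX t_ge0 sigmaF F_past) => //.
  by rewrite (_ : joint_survival _ _ _ _ _ = joint_survival X Gamma1 Gamma2 t1 t2);
    last exact: setIC.
Qed.
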